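(* Let $K$ be a real biquadratic field of type IV. Then the log-unit lattice $\Lambda_K$ is not orthogonal.
   Context: A real biquadratic field is $K=\mathbb{Q}(\sqrt{d_1},\sqrt{d_2})$ with $d_1,d_2>0$ rational and none of $d_1,d_2,d_1d_2$ a square in $\mathbb{Q}$. Its Galois group is generated by $\sigma,\tau$ with $\sigma(\sqrt{d_1})=-\sqrt{d_1}$, $\sigma(\sqrt{d_2})=\sqrt{d_2}$, $\tau(\sqrt{d_1})=\sqrt{d_1}$, $\tau(\sqrt{d_2})=-\sqrt{d_2}$. Fix $K\subset\mathbb{R}$ and define $\mathrm{Log}(x)=(\log|x|,\log|\tau(x)|,\log|\sigma(x)|,\log|\sigma\tau(x)|)\in\mathbb{R}^4$; $\Lambda_K=\mathrm{Log}(\mathcal{O}_K^\times)$. Units $u_1,u_2,u_3$ form a system of fundamental units if their Logs form a basis of $\Lambda_K$. Let $\epsilon_i$ be a fundamental unit of $K_i$, where $K_1=\mathbb{Q}(\sqrt{d_1})$, $K_2=\mathbb{Q}(\sqrt{d_2})$, $K_3=\mathbb{Q}(\sqrt{d_1d_2})$; $\sqrt{\alpha}$ denotes an element of $K$ with square $\alpha$. $K$ is of type IV if $\sqrt{\epsilon_1\epsilon_2\epsilon_3},\epsilon_2,\epsilon_3$ is a system of fundamental units. A lattice is orthogonal if it has a basis of pairwise orthogonal vectors (standard inner product). *)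

(* Defs.v *)
From HB Require Import structures.
From mathcomp Require Import all_boot all_order all_algebra all_fingroup all_field.
From mathcomp Require Import classical_sets reals exp.

Set Implicit Arguments.
Unset Strict Implicit.
Unset Printing Implicit Defensive.

Import Order.TTheory GRing.Theory Num.Theory.

Local Open Scope ring_scope.
Local Open Scope classical_set_scope.

(* The rows of B are a basis of Lambda: they are linearly independent over R
   and Lambda is the set of their integral combinations. *)
Definition lattice_basis (R : realType) (n k : nat)
    (Lambda : set 'rV[R]_n) (B : 'M[R]_(k, n)) : Prop :=
  row_free B /\
  Lambda = [set v | exists z : 'rV[int]_k, v = map_mx intr z *m B].

Definition dot (R : realType) (n : nat) (u v : 'rV[R]_n) : R :=
  \sum_(j < n) u 0 j * v 0 j.

Definition orthogonal_lattice (R : realType) (n : nat)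
    (Lambda : set 'rV[R]_n) : Prop :=
  exists (k : nat) (B : 'M[R]_(k, n)),
    lattice_basis Lambda B /\
    forall i j : 'I_k, i != j -> dot (row i B) (row j B) = 0.

Definition ring_of_integers (L : fieldExtType rat) (F : {subfield L}) : set L :=
  [set x | x \in F /\ integralOver (intr : int -> L) x].

Definition integer_units (L : fieldExtType rat) (F : {subfield L}) : set L :=
  [set x | ring_of_integers F x /\
           exists y, ring_of_integers F y /\ x * y = 1].

(* For a real quadratic field F, whose roots of unity are 1 and -1. *)
Definition fundamental_unit (L : fieldExtType rat) (F : {subfield L})
    (e : L) : Prop :=
  integer_units F e /\
  forall u, integer_units F u -> exists z : int, u = e ^ z \/ u = - e ^ z.

(* The field K is L itself, regarded as a subfield of R through rb_embed;
   rb_sqrt1 and rb_sqrt2 play the roles of sqrt d1 and sqrt d2. The elements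
   of gal_of {:L} are the automorphisms of L over rat. *)
Record real_biquadratic (R : realType) (L : splittingFieldType rat) := {
  rb_embed : {rmorphism L -> R};
  rb_d1 : rat;
  rb_d2 : rat;
  rb_d1_gt0 : 0 < rb_d1;
  rb_d2_gt0 : 0 < rb_d2;
  rb_d1_nonsquare : ~ exists q : rat, rb_d1 = q ^+ 2;
  rb_d2_nonsquare : ~ exists q : rat, rb_d2 = q ^+ 2;
  rb_d1d2_nonsquare : ~ exists q : rat, rb_d1 * rb_d2 = q ^+ 2;
  rb_sqrt1 : L;
  rb_sqrt2 : L;
  rb_sqrt1E : rb_embed rb_sqrt1 = Num.sqrt (ratr rb_d1);
  rb_sqrt2E : rb_embed rb_sqrt2 = Num.sqrt (ratr rb_d2);
  rb_generated : <<<<1; rb_sqrt1>>; rb_sqrt2>>%VS = {:L}%VS;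
  rb_sigma : gal_of {:L};
  rb_tau : gal_of {:L};
  rb_sigma1 : rb_sigma rb_sqrt1 = - rb_sqrt1;
  rb_sigma2 : rb_sigma rb_sqrt2 = rb_sqrt2;
  rb_tau1 : rb_tau rb_sqrt1 = rb_sqrt1;
  rb_tau2 : rb_tau rb_sqrt2 = - rb_sqrt2
}.

Definition Log (R : realType) (L : splittingFieldType rat)
    (K : real_biquadratic R L) (x : L) : 'rV[R]_4 :=
  \row_(j < 4) [:: ln `|rb_embed K x|;
                   ln `|rb_embed K (rb_tau K x)|;
                   ln `|rb_embed K (rb_sigma K x)|;
                   ln `|rb_embed K (rb_sigma K (rb_tau K x))|]`_j.

Definition log_unit_lattice (R : realType) (L : splittingFieldType rat)
    (K : real_biquadratic R L) : set 'rV[R]_4 :=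
  [set Log K x | x in integer_units {:L}].

Definition fundamental_units (R : realType) (L : splittingFieldType rat)
    (K : real_biquadratic R L) (u : 3.-tuple L) : Prop :=
  (forall i : 'I_3, integer_units {:L} (tnth u i)) /\
  lattice_basis (log_unit_lattice K) (\matrix_(i < 3) Log K (tnth u i)).

Definition type_IV (R : realType) (L : splittingFieldType rat)
    (K : real_biquadratic R L) : Prop :=
  exists e1 e2 e3 h : L,
    [/\ fundamental_unit <<1; rb_sqrt1 K>>%AS e1,
        fundamental_unit <<1; rb_sqrt2 K>>%AS e2,
        fundamental_unit <<1; rb_sqrt1 K * rb_sqrt2 K>>%AS e3,
        h ^+ 2 = e1 * e2 * e3
      & fundamental_units K [tuple h; e2; e3]].

(* Main.v *)
(* Units of quadratic fields have norm 1 or -1, so v_i = Log e_i are pairwise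
   orthogonal, and in type IV the lattice is body-centered: it is spanned by
   (v1 + v2 + v3)/2, v2 and v3. Each p = (v1 +- v2 +- v3)/2 is, up to sign, the
   only vector of its norm in its class modulo twice the lattice. In a lattice
   with an orthogonal basis such a vector is a multiple of a basis vector, so
   two non-parallel ones are orthogonal; the vectors p cannot all be. *)

Require Import Defs.
From mathcomp Require Import all_boot all_order all_algebra all_fingroup all_field.
From mathcomp Require Import classical_sets reals exp.
From mathcomp Require Import zify ring lra.

Set Implicit Arguments.
Unset Strict Implicit.
Unset Printing Implicit Defensive.

Import Order.TTheory GRing.Theory Num.Theory.

Local Open Scope ring_scope.
Local Open Scope classical_set_scope.

(** * Bilinearity and positivity of the dot product *)

Lemma dotC (R : realType) (n : nat) (u v : 'rV[R]_n) : dot u v = dot v u.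
Proof. by apply: eq_bigr => j _; rewrite mulrC. Qed.

Lemma dotDl (R : realType) (n : nat) (u v w : 'rV[R]_n) :
  dot (u + v) w = dot u w + dot v w.
Proof. by rewrite -big_split; apply: eq_bigr => j _; rewrite mxE mulrDl. Qed.

Lemma dotZl (R : realType) (n : nat) (a : R) (u w : 'rV[R]_n) :
  dot (a *: u) w = a * dot u w.
Proof. by rewrite /dot mulr_sumr; apply: eq_bigr => j _; rewrite mxE mulrA. Qed.

Lemma dotDr (R : realType) (n : nat) (u v w : 'rV[R]_n) :
  dot w (u + v) = dot w u + dot w v.
Proof. by rewrite dotC dotDl !(dotC w). Qed.

Lemma dotZr (R : realType) (n : nat) (a : R) (u w : 'rV[R]_n) :
  dot w (a *: u) = a * dot w u.
Proof. by rewrite dotC dotZl dotC. Qed.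

Lemma dot_gt0 (R : realType) (n : nat) (u : 'rV[R]_n) : u != 0 -> 0 < dot u u.
Proof.
move=> u0; have ge0 j : true -> 0 <= u 0 j * u 0 j by rewrite -expr2 sqr_ge0.
rewrite lt_def sumr_ge0 // andbT; apply: contraNneq u0 => /eqP.
rewrite psumr_eq0 // => /allP uu0; apply/eqP/rowP => j; rewrite mxE.
by apply/eqP; have := uu0 j (mem_index_enum j); rewrite mulf_eq0 orbb.
Qed.

Lemma dot_orthogonal_comb (R : realType) (n : nat) (v1 v2 v3 : 'rV[R]_n)
    (a1 a2 a3 b1 b2 b3 : R) :
  dot v1 v2 = 0 -> dot v1 v3 = 0 -> dot v2 v3 = 0 ->
  dot (a1 *: v1 + a2 *: v2 + a3 *: v3) (b1 *: v1 + b2 *: v2 + b3 *: v3) =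
  a1 * b1 * dot v1 v1 + a2 * b2 * dot v2 v2 + a3 * b3 * dot v3 v3.
Proof.
move=> v12 v13 v23; rewrite !(dotDl, dotDr, dotZl, dotZr).
rewrite (dotC v2 v1) (dotC v3 v1) (dotC v3 v2) v12 v13 v23; ring.
Qed.

Lemma int_comb_row (R : realType) (n k : nat) (B : 'M[R]_(k, n))
    (z : 'rV[int]_k) :
  map_mx intr z *m B = \sum_i (z 0 i)%:~R *: row i B.
Proof. by rewrite mulmx_sum_row; apply: eq_bigr => i _; rewrite mxE. Qed.

(** * Isolated vectors in orthogonal lattices *)

(** A variant of Voronoi's criterion for relevant vectors: p competes with the vectors of its own
    norm in p + 2 Lambda, instead of being shortest there. The zero vector qualifies, which accounts
    for the case [p = 0] below. *)
Definition isolated_in_class (R : realType) (n : nat) (Lambda : set 'rV[R]_n)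
    (p : 'rV[R]_n) : Prop :=
  Lambda p /\ forall w, Lambda w ->
    dot (p + 2 *: w) (p + 2 *: w) = dot p p ->
    p + 2 *: w = p \/ p + 2 *: w = - p.

(* Changing the sign of one coordinate of p in an orthogonal basis preserves
   both its norm and its class modulo 2 Lambda. *)
Lemma isolated_in_class_row (R : realType) (n k : nat)
    (Lambda : set 'rV[R]_n) (B : 'M[R]_(k, n)) (p : 'rV[R]_n) :
  lattice_basis Lambda B ->
  (forall i j : 'I_k, i != j -> dot (row i B) (row j B) = 0) ->
  isolated_in_class Lambda p ->
  p = 0 \/ exists (i : 'I_k) (a : R), p = a *: row i B.
Proof.
move=> [freeB ->] orthB [[z pE] pmin].
have [z0|z0] := eqVneq z 0; first by left; rewrite pE z0 map_mx0 mul0mx.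
right; have [i zi0] : exists i, z 0 i != 0.
  by apply/existsP; apply: contraNT z0 => /existsPn zi; apply/eqP/rowP => i;
    rewrite mxE; apply/eqP; have := zi i; rewrite negbK.
exists i, (z 0 i)%:~R.
have dotpi : dot p (row i B) = (z 0 i)%:~R * dot (row i B) (row i B).
  rewrite pE int_comb_row (bigD1 i) //= dotDl dotZl.
  rewrite [X in _ + X](_ : _ = 0) ?addr0 //.
  elim/big_rec: _ => [|j v ji IH].
    by rewrite /dot big1 // => j _; rewrite mxE mul0r.
  by rewrite dotDl dotZl IH orthB // mulr0 add0r.
set a : R := (z 0 i)%:~R in dotpi *.
have a0 : a != 0 by rewrite intr_eq0.
have bi0 : row i B != 0.
  apply/eqP => bi0; have : delta_mx 0 i = 0 :> 'rV[R]_k.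
    by apply: (row_free_inj freeB); rewrite /= -rowE bi0 mul0mx.
  by move/rowP/(_ i); rewrite !mxE !eqxx => /eqP; rewrite oner_eq0.
have wE : - a *: row i B = map_mx intr (- z 0 i *: delta_mx 0 i) *m B.
  by rewrite rowE scalemxAl map_mxZ map_delta_mx rmorphN.
(* Adding -2a times row i reflects p in the hyperplane orthogonal to that row, because a is the
   coordinate of p there. The reflection differs from p as a and the row are nonzero, so it is -p,
   and p is a times the row. *)
have [||/eqP|] := pmin (- a *: row i B).
- by exists (- z 0 i *: delta_mx 0 i).
- rewrite !(dotDl, dotDr, dotZl, dotZr) [dot (row i B) p]dotC dotpi; ring.
- rewrite -subr_eq0 addrAC subrr add0r scalerA scaler_eq0 (negPf bi0) orbF.
  by rewrite mulrN oppr_eq0 mulf_eq0 (negPf a0) pnatr_eq0.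
- move=> /rowP pN; apply/rowP => j; have := pN j; rewrite !mxE; lra.
Qed.

(** Both vectors are multiples of basis vectors: distinct ones are orthogonal, and a common one
    gives equality in Cauchy-Schwarz, which is how parallelism is expressed here. *)
Lemma isolated_in_class_dot (R : realType) (n : nat) (Lambda : set 'rV[R]_n)
    (p q : 'rV[R]_n) :
  orthogonal_lattice Lambda ->
  isolated_in_class Lambda p -> isolated_in_class Lambda q ->
  dot p q = 0 \/ dot p q ^+ 2 = dot p p * dot q q.
Proof.
move=> [k [B [basB orthB]]] pmin qmin.
have dot0 u : dot 0 u = 0 :> R by rewrite -(scale0r 0) dotZl mul0r.
have [->|[i [a ->]]] := isolated_in_class_row basB orthB pmin; first by left.
have [->|[j [b ->]]] := isolated_in_class_row basB orthB qmin.
  by left; rewrite dotC.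
rewrite !(dotZl, dotZr); have [->|/orthB->] := eqVneq i j; last by left; rewrite !mulr0.
by right; ring.
Qed.

(** * The body-centered lattice *)

(** The generators mirror the type IV units. The lattice is nevertheless symmetric in the three
    vectors, since v1 is twice the half-sum minus v2 and v3. *)
Definition body_centered (R : realType) (n : nat) (v1 v2 v3 : 'rV[R]_n) :
    set 'rV[R]_n :=
  [set w | exists x y z : int,
     w = x%:~R *: (2^-1 *: (v1 + v2 + v3)) + y%:~R *: v2 + z%:~R *: v3].

Lemma body_centered_swap (R : realType) (n : nat) (v1 v2 v3 : 'rV[R]_n) :
  body_centered v1 v2 v3 = body_centered v1 v3 v2.
Proof.
apply/seteqP; split => w [x [y [z ->]]]; exists x, z, y;
  by apply/rowP => j; rewrite !mxE; ring.
Qed.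

(** The half-sums (v1 + v2 + v3)/2 and (v1 + v2 - v3)/2 differ by v3, whence the coefficient -x - z
    of -v3. This lets results on the first half-sum be applied to the second. *)
Lemma body_centeredN (R : realType) (n : nat) (v1 v2 v3 : 'rV[R]_n) :
  body_centered v1 v2 v3 = body_centered v1 v2 (- v3).
Proof.
apply/seteqP; split => w [x [y [z ->]]]; exists x, y, (- x - z);
  by apply/rowP => j; rewrite !mxE rmorphB rmorphN /=; field.
Qed.

(** Vectors of the class have coordinates 1/2 + t with t an integer, so each coordinate has absolute
    value at least 1/2. Equal norm forces every coordinate to be 1/2 or -1/2, and a parity condition
    makes the signs agree. *)
Lemma body_centered_isolated (R : realType) (n : nat) (v1 v2 v3 : 'rV[R]_n) :
  v1 != 0 -> v2 != 0 -> v3 != 0 ->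
  dot v1 v2 = 0 -> dot v1 v3 = 0 -> dot v2 v3 = 0 ->
  isolated_in_class (body_centered v1 v2 v3) (2^-1 *: (v1 + v2 + v3)).
Proof.
move=> /dot_gt0 A0 /dot_gt0 B0 /dot_gt0 C0 v12 v13 v23; split.
  by exists 1, 0, 0; rewrite !scale0r !addr0 scale1r.
move=> w [x [y [z ->]]].
set p := 2^-1 *: _.
have pE : p = 2^-1 *: v1 + 2^-1 *: v2 + 2^-1 *: v3 by rewrite /p !scalerDr.
have -> : p + 2 *: (x%:~R *: p + y%:~R *: v2 + z%:~R *: v3) =
    (2^-1 + x%:~R) *: v1 + (2^-1 + (x + 2 * y)%:~R) *: v2
      + (2^-1 + (x + 2 * z)%:~R) *: v3.
  by rewrite pE; apply/rowP => j; rewrite !mxE !rmorphD !rmorphM /=; field.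
(* t(t + 1) is the excess of (1/2 + t)^2 over 1/4; no integer lies strictly between -1 and 0. *)
have gap0 (t : int) : 0 <= t * (t + 1) by nia.
have gapE (t : int) :
    (2^-1 + t%:~R) * (2^-1 + t%:~R) = 2^-1 * 2^-1 + (t * (t + 1))%:~R :> R.
  by rewrite rmorphM rmorphD /=; field.
rewrite {1 2}pE !dot_orthogonal_comb // !gapE => /eqP.
rewrite -subr_eq0 => /eqP sum0.
have {sum0} : (x * (x + 1))%:~R * dot v1 v1 +
    ((x + 2 * y) * (x + 2 * y + 1))%:~R * dot v2 v2 +
    ((x + 2 * z) * (x + 2 * z + 1))%:~R * dot v3 v3 = 0 :> R.
  by rewrite -[RHS]sum0; ring.
move=> /eqP; rewrite !paddr_eq0 ?addr_ge0 ?mulr_ge0 ?ler0z ?gap0 ?ltW //.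
rewrite !mulf_eq0 !intr_eq0 (gt_eqF A0) (gt_eqF B0) (gt_eqF C0) !orbF !mulf_eq0.
move=> /andP[/andP[hx hy] hz].
(* The three shifts are each 0 or -1 and have the parity of x, so they coincide. *)
have : x = 0 /\ x + 2 * y = 0 /\ x + 2 * z = 0 \/
    x = -1 /\ x + 2 * y = -1 /\ x + 2 * z = -1 by lia.
have halfN : 2^-1 + (-1)%:~R = - 2^-1 :> R by rewrite rmorphN1; field.
case=> [[-> [-> ->]]|[-> [-> ->]]]; [left|right]; rewrite pE.
  by rewrite addr0.
by rewrite halfN !scaleNr -!opprD.
Qed.

Lemma body_centered_not_orthogonal (R : realType) (n : nat)
    (v1 v2 v3 : 'rV[R]_n) :
  v1 != 0 -> v2 != 0 -> v3 != 0 ->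
  dot v1 v2 = 0 -> dot v1 v3 = 0 -> dot v2 v3 = 0 ->
  ~ orthogonal_lattice (body_centered v1 v2 v3).
Proof.
(* The dot products of p = (v1+v2+v3)/2 with q = (v1+v2-v3)/2 and with
   (v1-v2+v3)/2 vanish, so |v1|^2 + |v2|^2 = |v3|^2 and
   |v1|^2 + |v3|^2 = |v2|^2. *)
have main (u1 u2 u3 : 'rV[R]_n) :
    u1 != 0 -> u2 != 0 -> u3 != 0 ->
    dot u1 u2 = 0 -> dot u1 u3 = 0 -> dot u2 u3 = 0 ->
    orthogonal_lattice (body_centered u1 u2 u3) ->
    dot u1 u1 + dot u2 u2 = dot u3 u3.
  move=> u1n u2n u3n u12 u13 u23 orthL.
  have pmin := body_centered_isolated u1n u2n u3n u12 u13 u23.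
  have qmin : isolated_in_class (body_centered u1 u2 u3)
      (2^-1 *: (u1 + u2 - u3)).
    by rewrite body_centeredN; apply: body_centered_isolated => //;
      rewrite ?oppr_eq0 // -scaleN1r dotZr ?u13 ?u23 mulr0.
  have := isolated_in_class_dot orthL pmin qmin.
  have A0 := dot_gt0 u1n; have B0 := dot_gt0 u2n; have C0 := dot_gt0 u3n.
  rewrite !scalerDr scalerN -scaleNr !dot_orthogonal_comb //.
  move: (dot u1 u1) (dot u2 u2) (dot u3 u3) A0 B0 C0 => A B C A0 B0 C0.
  case=> [|eqC]; first by lra.
  (* Equality in Cauchy-Schwarz reads (A + B - C)^2 = (A + B + C)^2. *)
  have : (A + B) * C = 0.
    by move: eqC; lra.
  by move/eqP; rewrite mulf_eq0 !gt_eqF // addr_gt0.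
move=> v1n v2n v3n v12 v13 v23 orthL.
have e1 := main _ _ _ v1n v2n v3n v12 v13 v23 orthL.
rewrite body_centered_swap in orthL; rewrite dotC in v23.
have e2 := main _ _ _ v1n v3n v2n v13 v12 v23 orthL.
(* Adding [e1] and [e2] leaves 2|v1|^2 = 0. *)
by have := dot_gt0 v1n; lra.
Qed.

(** * Integrality and norms of units in quadratic fields *)

Lemma integral_int_rmorph (A B : nzRingType) (f : {rmorphism A -> B}) (x : A) :
  integralOver (intr : int -> A) x -> integralOver (intr : int -> B) (f x).
Proof.
case=> p monp rootp; exists p => //.
have -> : map_poly intr p = map_poly f (map_poly intr p).
  by rewrite -map_poly_comp; apply: eq_map_poly => i /=; rewrite rmorph_int.
exact: rmorph_root.
Qed.

(** The integers are integrally closed in the rationals: a monic integer polynomial vanishing at c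
    in L also vanishes at c in [algC], where rational algebraic integers are integers. *)
Lemma integral_rat_int (L : fieldExtType rat) (c : rat) :
  integralOver (intr : int -> L) c%:A -> c \is a Num.int.
Proof.
case=> p monp rootp; rewrite -Cint_rat; apply: Cint_rat_Aint.
  exact: Crat_rat.
apply: (@root_monic_Aint (map_poly intr p)).
- have -> : map_poly intr p = map_poly (ratr : rat -> algC) (map_poly intr p).
    by rewrite -map_poly_comp; apply: eq_map_poly => i /=; rewrite rmorph_int.
  rewrite fmorph_root -(fmorph_root (in_alg L)) -map_poly_comp.
  by rewrite (eq_map_poly (g := intr)) // => i; exact: (rmorph_int (in_alg L)).
- exact: monic_map.
- by apply/polyOverP => i; rewrite coef_map /= Num.Theory.intr_int.
Qed.

Lemma rational_integer_unit (L : fieldExtType rat) (c : rat) :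
  integer_units {:L}%AS c%:A -> c = 1 \/ c = -1.
Proof.
case=> -[_ /integral_rat_int /intrP[a ->]] [y [[_ yint] cy]].
have a0 : a%:~R != 0 :> rat.
  apply/eqP => a0; move/eqP: cy.
  by rewrite a0 scale0r mul0r eq_sym oner_eq0.
have yE : y = (a%:~R^-1 : rat)%:A.
  apply: (mulfI (x := a%:~R%:A)); first by rewrite scaler_eq0 oner_eq0 orbF.
  by rewrite cy -scalerAl mul1r scalerA divff // scale1r.
move: yint; rewrite yE => /integral_rat_int /intrP[b abE].
have : a * b = 1 by apply/eqP; rewrite -(eqr_int rat) rmorphM /= -abE divff.
move/(congr1 absz)/eqP; rewrite abszM muln_eq1 => /andP[/eqP absa _].
by have [->|->] : a = 1 \/ a = -1 by [lia]; [left|right].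
Qed.

Lemma quadratic_elt (L : fieldExtType rat) (s : L) (d : rat) (x : L) :
  s ^+ 2 = d%:A -> x \in <<1; s>>%VS -> exists a b : rat, x = a%:A + b *: s.
Proof.
move=> s2 /Fadjoin_polyP[p /polyOverP p1 ->]; rewrite horner_coef.
elim/big_rec: _ => [|i y _ [a [b ->]]]; first by exists 0, 0; rewrite !scale0r addr0.
have /vlineP[c ->] := p1 i; rewrite -(odd_double_half i) exprD -mul2n exprM s2.
rewrite -scalerAl mul1r exprZn expr1n -scalerAr mulr1.
case: (odd i); rewrite ?expr1 ?expr0 scalerA.
  by exists a, (c * d ^+ i./2 + b); rewrite scalerDl addrCA.
by exists (c * d ^+ i./2 + a), b; rewrite scalerDl addrA.
Qed.

Lemma quadratic_fixed (L : splittingFieldType rat) (rho : gal_of {:L})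
    (s : L) (d : rat) (x : L) :
  s ^+ 2 = d%:A -> rho s = s -> x \in <<1; s>>%VS -> rho x = x.
Proof.
move=> s2 rs /(quadratic_elt s2)[a [b ->]].
by rewrite linearD !linearZ /= rmorph1 rs.
Qed.

(** For x = a + b s the product [x * rho x] is the rational number a^2 - d b^2. It is an integral
    unit, with inverse [y * rho y], hence 1 or -1. *)
Lemma quadratic_unit_norm (L : splittingFieldType rat) (rho : gal_of {:L})
    (s : L) (d : rat) (x : L) :
  s ^+ 2 = d%:A -> rho s = - s -> integer_units <<1; s>>%AS x ->
  x * rho x = 1 \/ x * rho x = -1.
Proof.
move=> s2 rs [[xF xint] [y [[yF yint] xy]]].
have [a [b xE]] := quadratic_elt s2 xF.
have NE : x * rho x = (a ^+ 2 - b ^+ 2 * d)%:A.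
  rewrite xE linearD !linearZ /= rmorph1 rs scalerN mulrC -subr_sqr.
  by rewrite !exprZn expr1n s2 scalerA scalerBl.
have unitN : integer_units {:L}%AS (x * rho x).
  have intN u : integralOver (intr : int -> L) u ->
      ring_of_integers {:L}%AS (u * rho u).
    move=> uint; split; first exact: memvf.
    by apply: integral_mul => //; exact: integral_int_rmorph.
  split; first exact: intN.
  exists (y * rho y); split; first exact: intN.
  by rewrite mulrACA -rmorphM xy rmorph1 mulr1.
move: unitN; rewrite NE => /rational_integer_unit[->|->]; [left|right].
  by rewrite scale1r.
by rewrite scaleN1r.
Qed.

(** * Logarithmic vectors of quadratic units *)

Lemma ln_norm_unit (R : realType) (L : fieldType) (f : {rmorphism L -> R})
    (x y : L) :
  x * y = 1 \/ x * y = -1 -> ln `|f y| = - ln `|f x|.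
Proof.
move=> xy; have nxy : `|f x| * `|f y| = 1.
  by rewrite -normrM -rmorphM; case: xy => ->;
    rewrite ?rmorphN rmorph1 ?normrN normr1.
have x0 : 0 < `|f x|.
  by rewrite lt_def normr_ge0 andbT; apply: contra_eq_neq nxy => ->;
    rewrite mul0r eq_sym oner_eq0.
rewrite -lnV ?posrE //; congr ln; apply: (mulfI (lt0r_neq0 x0)).
by rewrite nxy mulfV ?lt0r_neq0.
Qed.

Lemma LogM (R : realType) (L : splittingFieldType rat)
    (K : real_biquadratic R L) (x y : L) :
  x != 0 -> y != 0 -> Log K (x * y) = Log K x + Log K y.
Proof.
have lnfM (u v : L) : u != 0 -> v != 0 ->
    ln `|rb_embed K (u * v)| = ln `|rb_embed K u| + ln `|rb_embed K v|.
  by move=> u0 v0; rewrite rmorphM normrM lnM // posrE normr_gt0 fmorph_eq0.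
move=> x0 y0; apply/rowP => j; rewrite !mxE.
by case: j => -[|[|[|[|//]]]] //= _;
  rewrite ?(rmorphM (rb_tau K)) ?(rmorphM (rb_sigma K)) lnfM ?fmorph_eq0.
Qed.

Lemma integer_unit_neq0 (L : fieldExtType rat) (F : {subfield L}) (x : L) :
  integer_units F x -> x != 0.
Proof.
case=> _ [y [_ xy]]; apply: contra_eq_neq xy => ->.
by rewrite mul0r eq_sym oner_eq0.
Qed.

Lemma rb_sqrt1_sqr (R : realType) (L : splittingFieldType rat)
    (K : real_biquadratic R L) : rb_sqrt1 K ^+ 2 = (rb_d1 K)%:A.
Proof.
apply: (fmorph_inj (rb_embed K)); rewrite rmorphXn rb_sqrt1E.
rewrite sqr_sqrtr ?ler0q ?(ltW (rb_d1_gt0 K)) //.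
by rewrite -(fmorph_eq_rat (rb_embed K \o in_alg L)).
Qed.

Lemma rb_sqrt2_sqr (R : realType) (L : splittingFieldType rat)
    (K : real_biquadratic R L) : rb_sqrt2 K ^+ 2 = (rb_d2 K)%:A.
Proof.
apply: (fmorph_inj (rb_embed K)); rewrite rmorphXn rb_sqrt2E.
rewrite sqr_sqrtr ?ler0q ?(ltW (rb_d2_gt0 K)) //.
by rewrite -(fmorph_eq_rat (rb_embed K \o in_alg L)).
Qed.

(** The signs record how 1, tau, sigma and sigma tau act on sqrt d1: a conjugate of x is x itself
    or, up to sign, its inverse. The next two lemmas do the same for the other quadratic subfields,
    giving the three nontrivial characters of the Galois group. *)
Lemma Log_unit1 (R : realType) (L : splittingFieldType rat)
    (K : real_biquadratic R L) (x : L) :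
  integer_units <<1; rb_sqrt1 K>>%AS x ->
  Log K x = ln `|rb_embed K x| *: \row_j [:: 1; 1; -1; -1]`_j.
Proof.
move=> ux; have xF : x \in <<1; rb_sqrt1 K>>%VS by case: ux => -[].
have s2 := rb_sqrt1_sqr K.
have tx := quadratic_fixed s2 (rb_tau1 K) xF.
have sx := ln_norm_unit (rb_embed K) (quadratic_unit_norm s2 (rb_sigma1 K) ux).
apply/rowP => j; rewrite !mxE tx; case: j => -[|[|[|[|//]]]] //= _;
  by rewrite ?sx ?mulrN mulr1.
Qed.

Lemma Log_unit2 (R : realType) (L : splittingFieldType rat)
    (K : real_biquadratic R L) (x : L) :
  integer_units <<1; rb_sqrt2 K>>%AS x ->
  Log K x = ln `|rb_embed K x| *: \row_j [:: 1; -1; 1; -1]`_j.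
Proof.
move=> ux; have xF : x \in <<1; rb_sqrt2 K>>%VS by case: ux => -[].
have s2 := rb_sqrt2_sqr K.
have sx := quadratic_fixed s2 (rb_sigma2 K) xF.
have Nx := quadratic_unit_norm s2 (rb_tau2 K) ux.
have tx := ln_norm_unit (rb_embed K) Nx.
have stx : ln `|rb_embed K (rb_sigma K (rb_tau K x))| = - ln `|rb_embed K x|.
  apply: ln_norm_unit.
  (* The norm, being 1 or -1, is unchanged by sigma, and sigma fixes x. *)
  have <- : rb_sigma K (x * rb_tau K x) = x * rb_sigma K (rb_tau K x).
    by rewrite rmorphM /= sx.
  by case: Nx => ->; rewrite ?rmorphN rmorph1; [left|right].
apply/rowP => j; rewrite !mxE; case: j => -[|[|[|[|//]]]] //= _;
  by rewrite ?sx ?tx ?stx ?mulrN mulr1.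
Qed.

Lemma Log_unit3 (R : realType) (L : splittingFieldType rat)
    (K : real_biquadratic R L) (x : L) :
  integer_units <<1; rb_sqrt1 K * rb_sqrt2 K>>%AS x ->
  Log K x = ln `|rb_embed K x| *: \row_j [:: 1; -1; -1; 1]`_j.
Proof.
move=> ux; have xF : x \in <<1; rb_sqrt1 K * rb_sqrt2 K>>%VS by case: ux => -[].
have s2 : (rb_sqrt1 K * rb_sqrt2 K) ^+ 2 = (rb_d1 K * rb_d2 K)%:A.
  by rewrite exprMn rb_sqrt1_sqr rb_sqrt2_sqr -scalerAl mul1r scalerA.
have sN : rb_sigma K (rb_sqrt1 K * rb_sqrt2 K) = - (rb_sqrt1 K * rb_sqrt2 K).
  by rewrite rmorphM /= rb_sigma1 rb_sigma2 mulNr.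
have tN : rb_tau K (rb_sqrt1 K * rb_sqrt2 K) = - (rb_sqrt1 K * rb_sqrt2 K).
  by rewrite rmorphM /= rb_tau1 rb_tau2 mulrN.
have sx := ln_norm_unit (rb_embed K) (quadratic_unit_norm s2 sN ux).
have tx := ln_norm_unit (rb_embed K) (quadratic_unit_norm s2 tN ux).
(* Both automorphisms negate the product of the square roots, so their composite fixes this
   subfield. *)
have stx : rb_sigma K (rb_tau K x) = x.
  have [a [b ->]] := quadratic_elt s2 xF.
  rewrite 2!linearD !linearZ /= !rmorph1 tN.
  by rewrite rmorphN /= sN opprK.
apply/rowP => j; rewrite !mxE stx; case: j => -[|[|[|[|//]]]] //= _;
  by rewrite ?sx ?tx ?mulrN mulr1.
Qed.

Theorem theorem6p5 (R : realType) (L : splittingFieldType rat)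
    (K : real_biquadratic R L) :
  type_IV K -> ~ orthogonal_lattice (log_unit_lattice K).
Proof.
case=> e1 [e2 [e3 [h [[u1 _] [u2 _] [u3 _] h2 [uh [freeU LambdaE]]]]]].
have h0 : h != 0 := integer_unit_neq0 (uh ord0).
have Logh : Log K h = 2^-1 *: (Log K e1 + Log K e2 + Log K e3).
  have n1 := integer_unit_neq0 u1; have n2 := integer_unit_neq0 u2.
  have n3 := integer_unit_neq0 u3.
  rewrite -!LogM ?mulf_neq0 // -h2 expr2 LogM //.
  by apply/rowP => j; rewrite !mxE; field.
(* The index 2 of ['I_3] is written [1 + 1]. *)
have comb (a : 'rV[R]_3) :
    a *m (\matrix_(i < 3) Log K (tnth [tuple h; e2; e3] i)) =
    a 0 0 *: Log K h + a 0 1 *: Log K e2 + a 0 (1 + 1) *: Log K e3.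
  rewrite mulmx_sum_row !big_ord_recl big_ord0 addr0 addrA !rowK.
  by congr (a 0 _ *: Log K _ + a 0 _ *: Log K _ + a 0 _ *: Log K _); apply/val_inj.
(* Independence will show that the three vectors [Log K e1], [Log K e2], [Log K e3] are nonzero. *)
have indep (a b c : R) :
    a *: Log K h + b *: Log K e2 + c *: Log K e3 = 0 -> [/\ a = 0, b = 0 & c = 0].
  pose r := \row_(j < 3) [:: a; b; c]`_j => abc0.
  have /rowP r0 : r = 0.
    by apply: (row_free_inj freeU); rewrite /= mul0mx comb !mxE.
  by split; [have := r0 0 | have := r0 1 | have := r0 (1 + 1)]; rewrite !mxE.
have -> : log_unit_lattice K = body_centered (Log K e1) (Log K e2) (Log K e3).
  rewrite LambdaE; apply/seteqP; split => w.
    by case=> z ->; exists (z 0 0), (z 0 1), (z 0 (1 + 1)); rewrite comb !mxE Logh.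
  case=> x [y [z ->]]; exists (\row_(j < 3) [:: x; y; z]`_j).
  by rewrite comb !mxE -Logh.
apply: body_centered_not_orthogonal.
(* The coefficients come from Log e1 = 2 Log h - Log e2 - Log e3. *)
- apply/eqP => v1; have [|/eqP] := indep 2 (-1) (-1); last by rewrite pnatr_eq0.
  by rewrite Logh v1; apply/rowP => j; rewrite !mxE; field.
- apply/eqP => v2; have [|_ /eqP] := indep 0 1 0; last by rewrite oner_eq0.
  by rewrite v2 !scale0r scaler0 !addr0.
- apply/eqP => v3; have [|_ _ /eqP] := indep 0 0 1; last by rewrite oner_eq0.
  by rewrite v3 !scale0r scaler0 !addr0.
(* The remaining goals are the orthogonality of distinct characters. *)
- rewrite (Log_unit1 u1) (Log_unit2 u2) dotZl dotZr /dot !big_ord_recl big_ord0.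
  by rewrite !mxE /=; ring.
- rewrite (Log_unit1 u1) (Log_unit3 u3) dotZl dotZr /dot !big_ord_recl big_ord0.
  by rewrite !mxE /=; ring.
- rewrite (Log_unit2 u2) (Log_unit3 u3) dotZl dotZr /dot !big_ord_recl big_ord0.
  by rewrite !mxE /=; ring.
Qed.
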